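(* Let $f(x)$ be a polynomial with real coefficients whose leading coefficient is positive, and suppose that $f$ has at least one positive real root $x = a$. Then there exists a real number $b \geq a$ such that, when $f(x)$ is divided by $x - b$ using the division algorithm, i.e. $f(x) = (x-b)\,q(x) + r$ with $q$ a real polynomial and $r \in \mathbb{R}$, the remainder $r$ is nonnegative and all the nonzero coefficients of the quotient polynomial $q(x)$ are positive. *)

(* Defs.v *)
From mathcomp Require Export all_boot all_order all_algebra.
From mathcomp Require Export reals.
Set Implicit Arguments.
Unset Strict Implicit.
Unset Printing Implicit Defensive.

(* Main.v *)
Require Import Defs.
From mathcomp Require Import all_boot all_order all_algebra.
From mathcomp Require Import reals.
From mathcomp Require Import ring.
Import Order.TTheory GRing.Theory Num.Theory.
Local Open Scope ring_scope.

(** Synthetic division of [f] by ['X - b] produces the coefficients of the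
    quotient, and finally the remainder, by the Horner recurrence
    [r |-> r * b + c], started from the leading coefficient [l] of [f], where
    [c] runs through the later coefficients.  If [l <= r] and [b] is at least
    [1 + `|c| / l], then [r * b + c >= l * b + c >= l], so for [b] beyond the
    largest of these finitely many bounds all values of the recurrence are
    at least [l > 0].  Such bounds leave [b] free to be taken above [a] as well.
    The lemma [synthetic_division_ge_lead] runs this argument by induction
    on [f]. *)

(** The bound [lead_coef f <= r], stronger than [0 <= r], is what makes the
    induction go through: the remainder for [f] becomes a coefficient of the
    quotient for [f * 'X + c%:P], and it must dominate [c] after
    multiplication by [b]. *)
Lemma synthetic_division_ge_lead (R : realFieldType) (f : {poly R}) :
  0 < lead_coef f ->
  exists B : R, forall b, B <= b ->
    exists (q : {poly R}) (r : R),
      [/\ f = ('X - b%:P) * q + r%:P,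
          lead_coef f <= r
        & forall i : nat, 0 <= q`_i].
Proof.
elim/poly_ind: f => [|g c IHg]; first by rewrite lead_coef0 ltxx.
have [->|g_neq0] := eqVneq g 0.
  rewrite mul0r add0r lead_coefC => _; exists 0 => b _; exists 0, c.
  by rewrite mulr0 add0r; split=> // i; rewrite coef0.
have -> : lead_coef (g * 'X + c%:P) = lead_coef g.
  rewrite lead_coefDl ?lead_coefMX // size_mulX //.
  by rewrite (leq_ltn_trans (size_polyC_leq1 c)) // ltnS lt0n size_poly_eq0.
move=> l_gt0; have [B hB] := IHg l_gt0.
set l := lead_coef g in l_gt0 hB *.
exists (Num.max B (1 + `|c| / l)) => b; rewrite ge_max => /andP[leBb leb].
have [q [r [g_eq ler q_ge0]]] := hB b leBb.
exists (q * 'X + r%:P), (r * b + c); split.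
- rewrite {1}g_eq rmorphD rmorphM /=; ring.
- have b_ge0 : 0 <= b.
    by apply: le_trans leb; rewrite addr_ge0 // divr_ge0 // ltW.
  have le_lb : l + `|c| <= r * b.
    apply: le_trans (ler_wpM2r b_ge0 ler).
    by rewrite -ler_pdivrMl // mulrDr mulVf ?gt_eqF // (mulrC l^-1).
  rewrite -lerBlDr; apply: le_trans le_lb.
  by rewrite lerD2l -normrN ler_norm.
- case=> [|i]; rewrite coefD coefMX coefC /=.
    by rewrite add0r; apply: le_trans ler; apply: ltW.
  by rewrite addr0.
Qed.

Theorem theorem1 (R : realType) (f : {poly R}) (a : R)
    (hlead : 0 < lead_coef f) (ha : 0 < a) (hroot : root f a) :
  exists b : R, a <= b /\
    exists (q : {poly R}) (r : R),
      [/\ f = ('X - b%:P) * q + r%:P,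
          0 <= r
        & forall i : nat, q`_i != 0 -> 0 < q`_i].
Proof.
have [B hB] := @synthetic_division_ge_lead R f hlead.
exists (Num.max a B); split; first by rewrite le_max lexx.
have [|q [r [f_eq ler q_ge0]]] := hB (Num.max a B).
  by rewrite le_max lexx orbT.
exists q, r; split=> // [|i qi_neq0]; first exact: le_trans (ltW hlead) ler.
by rewrite lt_def qi_neq0 q_ge0.
Qed.
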